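(* For all integers $k\geq 3$, the equality \[L(A_{k,k}) = (k-2)^2+1\] holds; that is, the limit $\lim_{n\to\infty}\left(\operatorname{Av}_n(A_{k,k})\right)^{1/n}$ exists and equals $(k-2)^2+1$.
   Context: A permutation $p=p_1p_2\cdots p_n$ of $\{1,\dots,n\}$ (written in one-line notation; $n$ is its length) contains the pattern $q=q_1q_2\cdots q_k$ (a permutation of $\{1,\dots,k\}$) if there are indices $i_1<i_2<\cdots<i_k$ such that, for all $r,s$, $p_{i_r}<p_{i_s}$ if and only if $q_r<q_s$. Otherwise $p$ avoids $q$. For a set $S$ of patterns, $p$ avoids $S$ if it avoids every pattern in $S$, and $\operatorname{Av}_n(S)$ denotes the number of permutations of length $n$ that avoid $S$. The exponential growth rate is $L(S)=\lim_{n\to\infty}\left(\operatorname{Av}_n(S)\right)^{1/n}$. Let $A_k$ be the set of the $k$ permutations of length $k$ whose first $k-1$ entries form an increasing sequence; equivalently, $A_k$ consists of the permutations $12\cdots(j-1)(j+1)\cdots k\,j$ for $1\leq j\leq k$. For $1\leq i\leq k$, let $A_{k,i}=A_k\setminus\{12\cdots(i-1)(i+1)\cdots k\,i\}$, that is, $A_k$ with its element whose last entry is $i$ removed. In particular, $A_{k,k}$ is $A_k$ with the increasing permutation $12\cdots k$ removed. *)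

(* Defs.v *)
From mathcomp Require Import all_boot all_order all_algebra all_fingroup.
From mathcomp Require Import all_classical all_reals all_analysis.

Set Implicit Arguments.
Unset Strict Implicit.
Unset Printing Implicit Defensive.

Import Order.TTheory GRing.Theory Num.Theory.
Import numFieldNormedType.Exports.

Local Open Scope nat_scope.

(* Positions and values are numbered from 0: the entry p_(i+1) of the one-line
   notation is (p i).+1, for p : 'S_n and i : 'I_n. *)

Definition contains_pattern (n k : nat) (p : 'S_n) (q : 'S_k) : bool :=
  [exists f : {ffun 'I_k -> 'I_n},
    [forall r : 'I_k, forall s : 'I_k, (r < s) ==> (f r < f s)] &&
    [forall r : 'I_k, forall s : 'I_k, (p (f r) < p (f s)) == (q r < q s)]].

Definition avoids (n k : nat) (p : 'S_n) (S : {set 'S_k}) : bool :=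
  [forall q in S, ~~ contains_pattern p q].

Definition Av (n k : nat) (S : {set 'S_k}) : nat :=
  #|[pred p : 'S_n | avoids p S]|.

(* Position s (from 0) is among the first k-1 exactly when s.+1 < k. *)
Definition Ak (k : nat) : {set 'S_k} :=
  finset (fun q : 'S_k =>
    [forall r : 'I_k, forall s : 'I_k, ((r < s) && (s.+1 < k)) ==> (q r < q s)]).

(* i is the 1-based value of the last entry. *)
Definition last_entry_is (k : nat) (q : 'S_k) (i : nat) : bool :=
  [exists r : 'I_k, (r.+1 == k) && ((q r).+1 == i)].

Definition Aki (k i : nat) : {set 'S_k} :=
  Ak k :\: finset (fun q : 'S_k => last_entry_is q i).

Local Open Scope ring_scope.
Local Open Scope classical_set_scope.

(* L(S) = l, including the existence of the limit. *)
Definition has_growth_rate (R : realType) (k : nat) (S : {set 'S_k}) (l : R)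
    : Prop :=
  (fun n : nat => (Av n S)%:R `^ (n%:R^-1) : R) @ \oo --> l.

(* Main.v *)
Require Import Defs.
From mathcomp Require Import all_boot all_order all_algebra all_fingroup.
From mathcomp Require Import all_classical all_reals all_analysis.
From mathcomp Require Import zify ring lra.

(** Put [D = k - 2]. A permutation avoids [A_{k,k}] exactly when each entry that
    ends an increasing subsequence of length [k - 1] is smaller than everything
    after it ([avoidsP]). So an avoider is a prefix without increasing subsequence
    of length [D + 1], followed by an increasing tail, with no relation imposed
    between the values of the two. The prefix splits into [D] decreasing classes,
    and a permutation of this kind is determined by the colour words of its
    positions and of its values, with the tail as an additional colour. Heuristically
    there are [binomial(n, j) * D^j * D^j] pairs of colour words with a prefix of
    length [j], and summing over [j] gives [(D^2 + 1)^n]. In terms of single words: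
    the pair of colour words is equivalent to one word over the alphabet
    [option ('I_D * 'I_D)], which has [D^2 + 1] letters.

    Upper bound. Colouring entries by their height, capped at [D], turns each avoider
    into such a word ([avoider_fits]), and the word determines the avoider
    ([fits_fun]). Hence [Av n <= (D^2 + 1)^n] ([Av_le]).

    Lower bound. Most permutations have many decompositions into decreasing classes,
    so a large family of words is needed for which the colour can be read off
    from the permutation. It is enough that both colour words have the ballot
    property (in each prefix smaller colours are at least as frequent as larger
    ones) and that all classes have the same size: then the colour of an entry is its
    capped height ([fits_graded], [graded_unique]). Ballot words are abundant, since
    the ballot property holds for any sequence of balanced blocks of bounded length
    that is preceded by a fixed word giving the smaller colours a sufficient lead
    ([assembled_ballot]). Balanced blocks are abundant too: among the words of
    length [l] some content is shared by a fraction of at least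
    [(l + 1)^-(D^2 + 1)] of them ([popular_content]), and concatenating [D] words of
    this content, recoloured by the [D] cyclic shifts of the colours, gives a
    balanced block. As [l] grows, the loss per letter tends to the factor 1
    ([Av_eventually_ge]). *)

Set Implicit Arguments.
Unset Strict Implicit.
Unset Printing Implicit Defensive.

Import Order.TTheory GRing.Theory Num.Theory.
Import numFieldNormedType.Exports.

Local Open Scope nat_scope.

(** * Counting and standardization *)


(** Both bounds on the number of avoiders compare permutations with words
    through the relation [fits] below, which is neither a function of the word
    nor of the permutation; this is the form of injection that they need. *)
Lemma leq_card_rel (A B : finType) (P : pred A) (Q : pred B) (R : A -> B -> Prop) :
  (forall a, P a -> exists2 b, Q b & R a b) ->
  (forall a a' b, P a -> P a' -> R a b -> R a' b -> a = a') ->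
  #|P| <= #|Q|.
Proof.
move=> exR injR.
pose f a := [pick b | Q b && `[< R a b >]].
have fP a : P a -> exists b, [/\ f a = Some b, Q b & R a b].
  move=> Pa; rewrite /f; case: pickP => [b /andP[Qb /asboolP Rab]|none].
    by exists b.
  by have [b Qb Rab] := exR a Pa; have := none b; rewrite Qb /= asboolT.
have injf : {in P &, injective f}.
  move=> a a' Pa Pa' eqf.
  have [b [fa _ Rab]] := fP a Pa; have [b' [fa' _ Rab']] := fP a' Pa'.
  move: eqf Rab'; rewrite fa fa' => -[<-]; exact: injR.
have Some_inj : injective (@Some B) by move=> b b' [].
rewrite -(card_in_imset injf) -(card_imset Q Some_inj).
apply/subset_leq_card/fintype.subsetP => o /imsetP[a Pa ->].
by have [b [-> Qb _]] := fP a Pa; apply: imset_f.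
Qed.

Lemma standardization n (key : 'I_n -> nat) : injective key ->
  exists s : 'S_n, forall x y, (s x < s y) = (key x < key y).
Proof.
move=> injk; pose r x := #|[pred z | key z < key x]|.
have r_lt x : r x < n.
  rewrite -[n in _ < n]card_ord; apply/proper_card/properP; split.
    exact/fintype.subsetP.
  by exists x => //; rewrite inE ltnn.
have r_mono x y : key x < key y -> r x < r y.
  move=> lt_xy; apply/proper_card/properP; split.
    by apply/fintype.subsetP => z; rewrite !inE => /ltn_trans; apply.
  by exists x; rewrite inE ?ltnn.
have r_inj : injective (fun x => Ordinal (r_lt x)).
  move=> x y /(congr1 val) /= eq_r; apply: injk.
  by case: (ltngtP (key x) (key y)) => // /r_mono; rewrite eq_r ltnn.
exists (perm r_inj) => x y; rewrite !permE /=.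
case: (ltngtP (key x) (key y)) => [/r_mono //| /r_mono | /injk ->].
  by move/ltnW; rewrite leqNgt => /negbTE.
by rewrite ltnn.
Qed.

(** * Avoidance in terms of increasing chains *)


(** An increasing subsequence of [m.+1] entries that ends at position [x]. *)
Fixpoint chain n (p : 'S_n) (m : nat) (x : 'I_n) : bool :=
  if m is m'.+1 then [exists y : 'I_n, [&& y < x, p y < p x & chain p m' y]]
  else true.

Lemma chain_seq n (p : 'S_n) m x : chain p m x ->
  exists s : seq 'I_n, [/\ size s = m,
    forall i j, i < j <= m -> nth x (rcons s x) i < nth x (rcons s x) j &
    forall i j, i < j <= m -> p (nth x (rcons s x) i) < p (nth x (rcons s x) j)].
Proof.
elim: m x => [|m IHm] x /=; first by exists [::]; split=> // i j; lia.
case/existsP=> y /and3P[lt_yx lt_pyx /IHm[s [sz_s ltx ltp]]].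
have nth_old i : i <= m -> nth x (rcons (rcons s y) x) i = nth y (rcons s y) i.
  move=> le_im; rewrite nth_rcons size_rcons sz_s ltnS le_im.
  by apply: set_nth_default; rewrite size_rcons sz_s.
have nth_new : nth x (rcons (rcons s y) x) m.+1 = x.
  by rewrite nth_rcons size_rcons sz_s ltnn eqxx.
have nth_y : nth y (rcons s y) m = y by rewrite nth_rcons sz_s ltnn eqxx.
have split_lt (h : 'I_n -> nat) : h y < h x ->
    (forall i j, i < j <= m -> h (nth y (rcons s y) i) < h (nth y (rcons s y) j)) ->
    forall i j, i < j <= m.+1 ->
      h (nth x (rcons (rcons s y) x) i) < h (nth x (rcons (rcons s y) x) j).
  move=> hyx IH i j /andP[lt_ij]; rewrite leq_eqVlt => /orP[/eqP ej|lt_jm].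
    subst j; rewrite nth_new nth_old //; move: lt_ij; rewrite ltnS leq_eqVlt.
    case/orP=> [/eqP->|lt_im]; first by rewrite nth_y.
    by apply: ltn_trans hyx; have := IH i m; rewrite nth_y; apply; rewrite lt_im /=.
  rewrite !nth_old //; last by lia.
  by apply: IH; rewrite lt_ij.
exists (rcons s y); split; first by rewrite size_rcons sz_s.
  exact: (split_lt (@nat_of_ord n)).
exact: (split_lt (fun z => p z)).
Qed.

(** The members of [Aki m.+2 m.+2] are the patterns made of an increasing run of
    length [m.+1] followed by an entry that is smaller than the end of the run:
    the first [m.+1] entries increase, and the last one is not the maximum, so
    the maximum is the end of the run. Avoiding all of them forbids every
    configuration consisting of an increasing subsequence of length [m.+1] and a
    later entry below its end. *)
Lemma avoidsP n (p : 'S_n) m :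
  reflect (forall x y : 'I_n, chain p m x -> x < y -> p x < p y)
          (avoids p (Aki m.+2 m.+2)).
Proof.
apply: (iffP idP) => [av x y chx lt_xy | tailP].
  case: (ltngtP (p x) (p y)) => // [lt_pyx | eq_p]; last first.
    by move: lt_xy; rewrite (perm_inj (val_inj eq_p)) ltnn.
  (* The chain followed by y is an occurrence of its own standardization q. *)
  have [s [sz_s ltx ltp]] := chain_seq chx.
  pose t := rcons (rcons s x) y; pose f (r : 'I_m.+2) := nth x t r.
  have f_old (r : 'I_m.+2) : r < m.+1 -> f r = nth x (rcons s x) r.
    by move=> lt_r; rewrite /f /t nth_rcons size_rcons sz_s lt_r.
  have f_last (r : 'I_m.+2) : r = m.+1 :> nat -> f r = y.
    by move=> e; rewrite /f /t nth_rcons size_rcons sz_s e ltnn eqxx.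
  have f_x : nth x (rcons s x) m = x by rewrite nth_rcons sz_s ltnn eqxx.
  have f_lt (r r' : 'I_m.+2) : r < r' -> f r < f r'.
    move=> lt_r; have := ltn_ord r'; rewrite ltnS leq_eqVlt => /orP[/eqP e|lt'].
      rewrite (f_last r') // f_old; last by lia.
      have : r <= m by lia.
      rewrite leq_eqVlt => /orP[/eqP->|ltm]; first by rewrite f_x.
      by apply: ltn_trans lt_xy; have := ltx r m; rewrite f_x; apply; rewrite ltm /=.
    by rewrite !f_old //; [apply: ltx; lia | lia].
  have f_inj : injective (fun r => val (p (f r))).
    move=> r r' /val_inj/perm_inj ef; apply: val_inj => /=.
    by case: (ltngtP r r') => // /f_lt; rewrite ef ltnn.
  have [q qP] := standardization f_inj.
  have qA : q \in Aki m.+2 m.+2.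
    rewrite /Aki finset.in_setD !inE; apply/andP; split.
      apply/existsP => -[r /andP[/eqP er /eqP eqr]].
      have lt_m : m < m.+2 by [].
      have : q r < q (Ordinal lt_m).
        by rewrite qP (f_last r); [rewrite f_old //= f_x | lia].
      by have := ltn_ord (q (Ordinal lt_m)); lia.
    apply/forallP=> r; apply/forallP=> r'; apply/implyP=> /andP[lt_r lt_m].
    by rewrite qP !f_old; [apply: ltp | |]; lia.
  move: av => /forallP/(_ q)/implyP/(_ qA)/negP[].
  apply/existsP; exists [ffun r => f r]; apply/andP; split.
    apply/forallP=> r; apply/forallP=> r'; rewrite !ffunE; apply/implyP.
    exact: f_lt.
  by apply/forallP=> r; apply/forallP=> r'; rewrite !ffunE qP.
apply/forallP=> q; apply/implyP; rewrite /Aki finset.in_setD !inE.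
case/andP=> lastq /forallP incq; apply/negP => /existsP[f /andP[/forallP fP /forallP pfP]].
have {}fP (r r' : 'I_m.+2) : r < r' -> f r < f r' by have /forallP/(_ r')/implyP := fP r.
have {}pfP (r r' : 'I_m.+2) : (p (f r) < p (f r')) = (q r < q r').
  by have /forallP/(_ r')/eqP := pfP r.
have {}incq (r r' : 'I_m.+2) : r < r' -> r'.+1 < m.+2 -> q r < q r'.
  by move=> lt_r lt_m; have /forallP/(_ r')/implyP := incq r; rewrite lt_r lt_m; apply.
have chainf i (r : 'I_m.+2) : r = i :> nat -> r < m.+1 -> chain p i (f r).
  elim: i r => [//|i IHi] r er lt_r /=.
  have lt_i : i < m.+2 by lia.
  apply/existsP; exists (f (Ordinal lt_i)); rewrite IHi //=; last by lia.
  by rewrite fP /= ?er // pfP incq //= er.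
have lt_m : m < m.+2 by [].
have := tailP (f (Ordinal lt_m)) (f ord_max).
rewrite chainf // fP // pfP => /(_ isT isT); apply/negP; rewrite -leqNgt.
have max_q : exists r, q r = ord_max by exists ((q^-1)%g ord_max); rewrite permKV.
have [r qr] := max_q.
have r_max : r != ord_max.
  apply: contraNneq lastq => er; apply/existsP; exists r.
  by rewrite qr er /= !eqxx.
have le_rm : r <= m by have := ltn_ord r; move: r_max; rewrite -val_eqE /=; lia.
suff -> : Ordinal lt_m = r by rewrite qr -ltnS ltn_ord.
apply: val_inj => /=; move: le_rm; rewrite leq_eqVlt => /orP[/eqP//|lt_rm].
have := incq r (Ordinal lt_m) lt_rm (ltnSn _).
by rewrite qr /=; have := ltn_ord (q (Ordinal lt_m)); lia.
Qed.

(** * Permutations encoded by two colour words *)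


(** [u] colours the positions of [p] and [v] its values. Each colour below [d]
    marks a decreasing subsequence, while colour [d] marks an increasing one, the
    tail of the permutation. The default value of [nth] is immaterial as long as
    both words have size [n]. *)
Definition fits d (u v : seq nat) n (p : 'S_n) : Prop :=
  (forall x, nth d v (p x) = nth d u x) /\
  (forall x y : 'I_n, x < y -> nth d u x = nth d u y ->
     if nth d u x < d then p y < p x else p x < p y).

(** Inside one colour class the order of the values is prescribed, so [p] maps
    the positions of a colour in [u] onto the values of that colour in [v] in only
    one way. The proof shows that the permutation of values relating two solutions
    preserves colours and preserves the order within each of them, hence is the
    identity. *)
Lemma fits_fun d u v n (p p' : 'S_n) :
  fits d u v p -> fits d u v p' -> p = p'.
Proof.
move=> [col mono] [col' mono'].
suff fixed y : p' ((p^-1)%g y) = y.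
  by apply/permP => x; rewrite -(fixed (p x)) permK.
move: y.
have order (z y : 'I_n) : z < y -> nth d v z = nth d v y ->
    p' ((p^-1)%g z) < p' ((p^-1)%g y).
  set a := ((p^-1)%g z); set b := ((p^-1)%g y) => lt_zy eqv.
  have pa : p a = z by rewrite permKV.
  have pb : p b = y by rewrite permKV.
  have eqab : nth d u a = nth d u b by rewrite -!col pa pb.
  case: (ltngtP a b) => [ltab|ltba|/val_inj eab]; last first.
  - by move: lt_zy; rewrite -pa -pb eab ltnn.
  - have := mono _ _ ltba (esym eqab); have := mono' _ _ ltba (esym eqab).
    by rewrite pa pb; case: ifP => // _ _; lia.
  - have := mono _ _ ltab eqab; have := mono' _ _ ltab eqab.
    by rewrite pa pb; case: ifP => // _ _; lia.
have color (z : 'I_n) : nth d v (p' ((p^-1)%g z)) = nth d v z.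
  by rewrite col' -col permKV.
move=> y; have [m] := ubnP (val y); elim: m y => // m IHm y; rewrite ltnS => le_ym.
have IH (z : 'I_n) : z < y -> p' ((p^-1)%g z) = z.
  by move=> lt_zy; apply/IHm/(leq_trans lt_zy).
set w := p' _; case: (ltngtP w y) => [lt_wy|lt_yw|/val_inj//].
  have /perm_inj/perm_inj e : p' ((p^-1)%g w) = p' ((p^-1)%g y) by apply: IH.
  by move: lt_wy; rewrite e ltnn.
have [z zP] : exists z, p' ((p^-1)%g z) = y.
  by exists (p ((p'^-1)%g y)); rewrite permK permKV.
case: (ltngtP z y) => [lt_zy|lt_yz|/val_inj e].
- by have := IH z lt_zy; rewrite zP => e; move: lt_zy; rewrite e ltnn.
- have := order y z lt_yz; rewrite zP -/w -(color z) zP => /(_ erefl).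
  by rewrite ltnNge ltnW.
- by rewrite /w -{1}e zP.
Qed.

Lemma sorted_colors n (key col : 'I_n -> nat) (s : 'S_n) :
  (forall x y, (s x < s y) = (key x < key y)) ->
  (forall x y, key x < key y -> col x <= col y) ->
  sorted leq [seq col ((s^-1)%g i) | i <- enum 'I_n].
Proof.
move=> sP colP; rewrite sorted_map.
have: sorted (relpre val ltn) (enum 'I_n).
  by rewrite -sorted_map val_enum_ord iota_ltn_sorted.
apply: sub_sorted => i j /= lt_ij; apply: colP.
by rewrite -sP !permKV.
Qed.

Lemma perm_colors d n (u : seq nat) (s : 'S_n) : size u = n ->
  perm_eq [seq nth d u (s i) | i <- enum 'I_n] u.
Proof.
move=> sz_u; have -> : [seq nth d u (s i) | i <- enum 'I_n] =
    [seq nth d u i | i : 'I_n <- [seq s i | i <- enum 'I_n]].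
  by rewrite -[RHS]map_comp.
have uE : u = [seq nth d u i | i : 'I_n <- enum 'I_n].
  by rewrite (map_comp (nth d u) val) val_enum_ord -sz_u map_nth_iota0 ?take_size.
rewrite [X in perm_eq _ X]uE; apply/perm_map/uniq_perm; rewrite ?enum_uniq ?(map_inj_uniq perm_inj) ?enum_uniq //.
move=> x; rewrite mem_enum inE; apply/mapP; exists ((s^-1)%g x).
  by rewrite mem_enum.
by rewrite permKV.
Qed.

(** Sort the positions by colour, then by place, and the values by colour, then
    in the direction prescribed for that colour; matching the two sorted lists
    gives [p]. *)
Lemma fits_exists d u v n : perm_eq u v -> size u = n ->
  exists p : 'S_n, fits d u v p.
Proof.
move=> uv sz_u; have sz_v : size v = n by rewrite -(perm_size uv).
(* Lexicographic keys: the colour comes first, then a number below n. *)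
pose ku (x : 'I_n) := nth d u x * n + x.
pose kv (y : 'I_n) := nth d v y * n + (if nth d v y < d then n.-1 - y else y).
have lt_key a b i j : i < n -> j < n -> a * n + i < b * n + j ->
    a < b \/ a = b /\ i < j.
  move=> lt_i lt_j; case: (ltngtP a b) => [|lt_ba|->]; [by left| |]; last first.
    by right; split=> //; lia.
  have : b.+1 * n <= a * n by rewrite leq_mul2r lt_ba orbT.
  by rewrite mulSn; lia.
have kvb (y : 'I_n) : (if nth d v y < d then n.-1 - y else y) < n.
  by case: ifP => _; have := ltn_ord y; lia.
have ku_lt x y : ku x < ku y -> nth d u x < nth d u y \/
     nth d u x = nth d u y /\ x < y by apply: lt_key.
have kv_lt x y : kv x < kv y -> nth d v x < nth d v y \/
     nth d v x = nth d v y /\ (if nth d v x < d then y < x else x < y).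
  move=> /(lt_key _ _ _ _ (kvb x) (kvb y))[|[e lt]]; [by left|right; split=> //].
  by move: lt; rewrite -e; case: ifP => _; have := ltn_ord x; have := ltn_ord y; lia.
have ku_inj : injective ku.
  move=> x y e; apply: val_inj => /=; move: e; rewrite /ku.
  have := ltn_ord x; have := ltn_ord y; move: (nth d u x) (nth d u y) => a b.
  move=> ly lx e; case: (ltngtP a b) => [lt|lt|eab].
  - by have : a.+1 * n <= b * n by [rewrite leq_mul2r lt orbT]; rewrite mulSn; lia.
  - by have : b.+1 * n <= a * n by [rewrite leq_mul2r lt orbT]; rewrite mulSn; lia.
  - by move: e; rewrite eab; lia.
have kv_inj : injective kv.
  move=> x y; rewrite /kv; have := kvb x; have := kvb y; have := ltn_ord x.
  have := ltn_ord y; move: (nth d v x) (nth d v y) => a b ly lx.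
  set i := (if a < d then _ else _); set j := (if b < d then _ else _) => lj li e.
  apply: val_inj => /=; case: (ltngtP a b) => [lt|lt|eab].
  - by have : a.+1 * n <= b * n by [rewrite leq_mul2r lt orbT]; rewrite mulSn; lia.
  - by have : b.+1 * n <= a * n by [rewrite leq_mul2r lt orbT]; rewrite mulSn; lia.
  - by move: e; rewrite /i /j eab; case: ifP => _; lia.
have [su suP] := standardization ku_inj; have [sv svP] := standardization kv_inj.
have colors : [seq nth d u ((su^-1)%g i) | i <- enum 'I_n] =
              [seq nth d v ((sv^-1)%g i) | i <- enum 'I_n].
  apply: (sorted_eq leq_trans anti_leq).
  - by apply: (sorted_colors (col := fun x : 'I_n => nth d u x) suP) => x y /ku_lt[/ltnW //|[->]].
  - by apply: (sorted_colors (col := fun x : 'I_n => nth d v x) svP) => x y /kv_lt[/ltnW //|[->]].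
  - apply: perm_trans (perm_colors d (su^-1)%g sz_u) _; apply: perm_trans uv _.
    by rewrite perm_sym; apply: perm_colors.
have colorsE i : nth d u ((su^-1)%g i) = nth d v ((sv^-1)%g i).
  by move/eq_in_map: colors; apply; rewrite mem_enum.
pose p := (su * sv^-1)%g.
have pE x : p x = (sv^-1)%g (su x) by rewrite permM.
have vp x : nth d v (p x) = nth d u x by rewrite pE -colorsE permK.
exists p; split=> // x y lt_xy eq_u.
have : kv (p x) < kv (p y).
  by rewrite -svP !pE !permKV suP /ku eq_u ltn_add2l.
move/kv_lt; rewrite !vp eq_u ltnn => -[//|[_]] //.
Qed.

(** * Words over an alphabet with d^2 + 1 letters *)
Notation letter d := (option ('I_d * 'I_d)).

(** A word [e] of length [n] encodes both colour words at once. Its letters stand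
    for the values of the permutation in increasing order: [None] for a value in
    the tail, and [Some (a, c)] for a value of colour [c]. The colours [a], read
    in order, are those of the positions before the tail; this is possible because
    there are as many such positions as values outside the tail. *)
Definition firsts d (e : seq (letter d)) : seq nat :=
  [seq val q.1 | q <- pmap id e].

Definition posword d (e : seq (letter d)) : seq nat :=
  firsts e ++ nseq (count_mem None e) d.

Definition valword d (e : seq (letter d)) : seq nat :=
  [seq if o is Some q then val q.2 else d | o <- e].

Lemma size_firsts d (e : seq (letter d)) :
  size (firsts e) + count_mem None e = size e.
Proof.
by rewrite /firsts size_map; elim: e => [//|[q|] e /= <-]; lia.
Qed.

Lemma size_posword d (e : seq (letter d)) : size (posword e) = size e.
Proof. by rewrite size_cat size_nseq size_firsts. Qed.

Lemma size_valword d (e : seq (letter d)) : size (valword e) = size e.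
Proof. by rewrite size_map. Qed.

Lemma count_tail d (e : seq (letter d)) :
  count_mem d (valword e) = count_mem None e.
Proof.
elim: e => [//|[q|] e /= ->]; last by rewrite eqxx.
by rewrite (ltn_eqF (ltn_ord q.2)).
Qed.

Lemma words_inj d (e e' : seq (letter d)) :
  posword e = posword e' -> valword e = valword e' -> e = e'.
Proof.
move=> eq_u eq_v.
have eq_f : firsts e = firsts e'.
  move: eq_u; rewrite /posword -!count_tail eq_v => /eqP.
  rewrite eqseq_cat ?eqxx ?andbT => [/eqP //|].
  have := congr1 size eq_v; rewrite !size_valword -!size_firsts.
  by rewrite -!count_tail eq_v => /addIn.
elim: e e' eq_f eq_v {eq_u} => [|o e IHe] [|o' e'] //=.
case: o o' => [[a b]|] [[a' b']|] //=.
- move=> [/val_inj -> eq_f] [/val_inj -> eq_v]; congr cons; exact: IHe.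
- by move=> _ [eb]; have := ltn_ord b; rewrite eb ltnn.
- by move=> _ [eb]; have := ltn_ord b'; rewrite -eb ltnn.
- by move=> eq_f [eq_v]; congr cons; apply: IHe.
Qed.

Lemma words_exist d (a v : seq nat) :
  all (ltn^~ d) a -> all (leq^~ d) v -> size a = count (ltn^~ d) v ->
  exists e : seq (letter d), firsts e = a /\ valword e = v.
Proof.
elim: v a => [|c v IHv] [|b a] //=; first by exists [::].
- move=> _ /andP[le_c le_v]; case: ltnP => //= ge_c sz.
  have [e [ea ev]] := IHv [::] isT le_v sz.
  by exists (None :: e); split=> //=; rewrite ev; congr cons; apply/anti_leq/andP.
- case/andP=> lt_b lt_a /andP[le_c le_v]; case: ltnP => /= [lt_c [sz]|ge_c sz].
    have [e [ea ev]] := IHv a lt_a le_v sz.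
    exists (Some (Ordinal lt_b, Ordinal lt_c) :: e).
    by rewrite /firsts /= -/(firsts e) ea ev.
  have [|e [ea ev]] := IHv (b :: a) _ le_v sz; first by rewrite /= lt_b.
  by exists (None :: e); split=> //=; rewrite ev; congr cons; apply/anti_leq/andP.
Qed.

(** In the position word of an avoider the tail colour, once it has occurred, is
    never left. *)
Lemma tail_split d (u : seq nat) : all (leq^~ d) u ->
  pairwise (fun a b => (a == d) ==> (b == d)) u ->
  u = [seq c <- u | c < d] ++ nseq (count_mem d u) d.
Proof.
elim: u => [//|a u IHu] /= /andP[le_a le_u] /andP[all_a pw_u].
case: ltnP => [lt_a|ge_a]; first by rewrite (ltn_eqF lt_a) /= -IHu.
have ea : a = d by apply/anti_leq/andP.
rewrite ea eqxx /= in all_a *.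
have all_d : all (pred1 d) u by [].
rewrite (eq_in_filter (a2 := pred0)) ?filter_pred0 => [|x x_u]; last first.
  by rewrite /= (eqP (allP all_d x x_u)) ltnn.
by move: all_d; rewrite all_count => /eqP ->; congr cons; apply/all_pred1P.
Qed.

(** * The upper bound *)


(** The colour of an entry: the number of entries that can precede it in an
    increasing chain, capped at [d]. *)
Definition height n (p : 'S_n) d x := \max_(m < d.+1 | chain p m x) m.

Lemma height_le n (p : 'S_n) d x : height p d x <= d.
Proof. by apply/bigmax_leqP => m _; rewrite -ltnS. Qed.

Lemma chain_height n (p : 'S_n) d x : chain p (height p d x) x.
Proof.
rewrite /height (bigop.bigmax_eq_arg ord0 (P := fun m : 'I_d.+1 => chain p m x)) //.
by case: arg_maxnP.
Qed.

Lemma leq_height n (p : 'S_n) d x m : m <= d -> chain p m x -> m <= height p d x.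
Proof.
rewrite -ltnS => lt_m ch.
exact: (@leq_bigmax_cond _ (fun m : 'I_d.+1 => chain p m x) _ (Ordinal lt_m)).
Qed.

(** Entries of equal height below [d] cannot form an increasing pair, since the
    second one would have a larger height. After an entry of height [d] avoidance
    makes everything larger, hence again of height [d]: these entries are an
    increasing suffix. *)
Lemma avoider_fits n (p : 'S_n) d : avoids p (Aki d.+2 d.+2) ->
  exists e : n.-tuple (letter d), fits d (posword e) (valword e) p.
Proof.
move=> /avoidsP tailP; pose h := height p d.
have step (x y : 'I_n) : x < y -> p x < p y -> h x < d -> h x < h y.
  move=> lt_xy lt_p lt_h; apply: leq_height => //=.
  by apply/existsP; exists x; rewrite lt_xy lt_p chain_height.
have stepd (x y : 'I_n) : x < y -> h x = d -> p x < p y /\ h y = d.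
  move=> lt_xy hx; have chx : chain p d x by rewrite -hx; apply: chain_height.
  have lt_p := tailP _ _ chx lt_xy; split=> //.
  apply/eqP; rewrite eqn_leq height_le /=; apply: leq_height => //.
  case: (d) chx => // d' chx /=.
  apply/existsP; exists x; rewrite lt_xy lt_p /=.
  have chainS m z : chain p m.+1 z -> chain p m z.
    elim: m z => // m IHm z /= /existsP[w /and3P[lt_w lt_pw ch]].
    by apply/existsP; exists w; rewrite lt_w lt_pw IHm.
  exact: chainS.
pose u := [seq h x | x <- enum 'I_n].
pose v := [seq h ((p^-1)%g y) | y <- enum 'I_n].
have nth_u (x : 'I_n) : nth d u x = h x.
  by rewrite (nth_map x) ?size_enum_ord // nth_ord_enum.
have nth_v (x : 'I_n) : nth d v (p x) = h x.
  by rewrite (nth_map x) ?size_enum_ord // nth_ord_enum permK.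
have sz_u : size u = n by rewrite size_map size_enum_ord.
have uv : perm_eq v u.
  have -> : v = [seq nth d u ((p^-1)%g y) | y <- enum 'I_n].
    by apply: eq_map => y; rewrite nth_u.
  exact: perm_colors.
have le_u : all (leq^~ d) u by apply/allP => c /mapP[x _ ->]; apply: height_le.
have uE := tail_split le_u.
have [|||e [ea ev]] := @words_exist d ([seq c <- u | c < d]) v.
- exact: filter_all.
- by rewrite (perm_all _ uv).
- by rewrite size_filter (seq.permP uv).
have sz_e : size e == n by rewrite -size_valword ev (perm_size uv) sz_u.
exists (Tuple sz_e) => /=; rewrite ev.
have -> : posword e = u.
  rewrite /posword ea -count_tail ev (seq.permP uv) -uE //.
  rewrite pairwise_map.
  have: pairwise (relpre val ltn) (enum 'I_n).
    rewrite -pairwise_map val_enum_ord.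
    by rewrite -(sorted_pairwise ltn_trans) iota_ltn_sorted.
  apply: sub_pairwise => x y /= lt_xy; apply/implyP => /eqP hx.
  by have [_ ->] := stepd x y lt_xy hx.
split=> [x|x y lt_xy]; first by rewrite nth_u nth_v.
rewrite !nth_u => eq_h; case: ltnP => [lt_h|ge_h].
  case: (ltngtP (p x) (p y)) => // [lt_p|/val_inj/perm_inj e_xy].
    by have := step x y lt_xy lt_p lt_h; rewrite eq_h ltnn.
  by rewrite e_xy ltnn in lt_xy.
have hx : h x = d by apply/eqP; rewrite eqn_leq height_le.
by have [] := stepd x y lt_xy hx.
Qed.

Lemma Av_le n d : Av n (Aki d.+2 d.+2) <= (d ^ 2 + 1) ^ n.
Proof.
have -> : (d ^ 2 + 1) ^ n = #|{: n.-tuple (letter d)}|.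
  by rewrite card_tuple card_option card_prod !card_ord addn1 mulnn.
apply: (@leq_card_rel _ _ _ predT
  (fun (p : 'S_n) (e : n.-tuple (letter d)) => fits d (posword e) (valword e) p)).
- by move=> p av; have [e] := avoider_fits av; exists e.
- by move=> p p' e _ _; apply: fits_fun.
Qed.

(** * Recovering the colours from the permutation *)


(** The offset [o] counts the letters that have already been read; it makes the
    ballot property compatible with concatenation. *)
Definition ballot_from d (o : nat -> nat) (w : seq nat) : Prop :=
  forall m c c', c < c' < d ->
    o c' + count_mem c' (take m w) <= o c + count_mem c (take m w).

Definition ballot d (w : seq nat) : Prop := ballot_from d (fun=> 0) w.

Lemma count_take_mono (a : pred nat) w m m' :
  m <= m' -> count a (take m w) <= count a (take m' w).
Proof.
by move=> le_m; rewrite -(take_takel w le_m) -{2}(cat_take_drop m (take m' w)) count_cat leq_addr.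
Qed.

(** In a ballot word the [i]-th occurrence of a smaller letter precedes the [i]-th
    occurrence of a larger one. *)
Lemma ballot_lt d w c c' x x' : ballot d w -> c < c' < d -> x' < size w ->
  nth d w x = c -> nth d w x' = c' ->
  count_mem c (take x w) <= count_mem c' (take x' w) -> x < x'.
Proof.
move=> bal lt_c lt_x' wx wx' le_count; rewrite ltnNge; apply/negP => le_x.
have {}le_x : x' < x.
  rewrite ltn_neqAle le_x andbT; apply/eqP => e.
  by move: lt_c; rewrite -wx -wx' e ltnn.
have := bal x'.+1 c c' lt_c; rewrite !add0n (take_nth d lt_x') wx'.
have := count_take_mono (pred1 c) w le_x.
rewrite (take_nth d lt_x') wx' -!cats1 !count_cat /= eqxx => h1 h2.
by have := leq_trans (leq_trans h2 h1) le_count; rewrite addn0 addn1 ltnn.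
Qed.

Lemma nth_occurrence d (w : seq nat) c i : i < count_mem c w ->
  exists x, [/\ x < size w, nth d w x = c & count_mem c (take x w) = i].
Proof.
elim: w i => [|a w IHw] i //=; case: (altP (a =P c)) => [ea|ne_a] /=.
  case: i => [_|i]; first by exists 0.
  rewrite add1n ltnS => /IHw[x [lt_x wx cx]].
  by exists x.+1; split=> //=; rewrite ea eqxx cx.
rewrite add0n => /IHw[x [lt_x wx cx]].
by exists x.+1; split=> //=; rewrite (negbTE ne_a) cx.
Qed.

Lemma count_take_card d n (w : seq nat) c m : size w = n -> m <= n ->
  count_mem c (take m w) = \sum_(i < n) ((i < m) && (nth d w i == c)).
Proof.
move=> sz_w le_m; rewrite -sum1_count (big_nth d) size_takel ?sz_w //.
rewrite big_mkcond [RHS](eq_bigr (fun i : 'I_n =>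
  if i < m then if nth d w i == c then 1 else 0 else 0)); last first.
  by move=> i _; case: (i < m); case: (_ == _).
rewrite -(big_mkord xpredT (fun i => if i < m then if nth d w i == c then 1 else 0 else 0)).
rewrite -[RHS]big_mkcond /= -[RHS](big_nat_widen 0 m n xpredT _ le_m).
rewrite big_nat_cond [RHS]big_nat_cond; apply: eq_bigr => i /andP[/andP[_ lt_i] _].
by rewrite nth_take //=.
Qed.

(** The [i]-th position of a decreasing class carries the [i]-th largest value of
    that class: its index among the positions and its index among the values add
    up to the size of the class minus one. *)
Lemma fits_index d n u v (p : 'S_n) (x : 'I_n) :
  size u = n -> size v = n ->
  fits d u v p -> nth d u x < d ->
  (count_mem (nth d u x) (take (p x) v) + count_mem (nth d u x) (take x u)).+1 =
    count_mem (nth d u x) u.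
Proof.
move=> sz_u sz_v [col mono] lt_x; set c := nth d u x in lt_x *.
rewrite -[in RHS](take_size u) sz_u.
rewrite (count_take_card d c sz_u (leqnn n)).
rewrite (count_take_card d c sz_u (ltnW (ltn_ord x))).
rewrite (count_take_card d c sz_v (ltnW (ltn_ord (p x)))).
rewrite (reindex_inj (perm_inj (s := p))) /= -big_split /= -addn1.
have <- : \sum_(i < n) (i == x) = 1.
  by rewrite -big_mkcond /= (big_pred1 x).
rewrite -big_split; apply: eq_bigr => y _ /=.
rewrite col ltn_ord /=; case: (altP (nth d u y =P c)) => [eq_y|ne_y]; last first.
  by rewrite !andbF; case: eqP => // e; rewrite e eqxx in ne_y.
rewrite !andbT; case: (ltngtP y x) => [lt_yx|lt_xy|/val_inj ->].
- have := mono y x lt_yx eq_y; rewrite eq_y lt_x => /ltnW; rewrite leqNgt => /negbTE ->.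
  by rewrite -val_eqE /= (ltn_eqF lt_yx).
- have := mono x y lt_xy (esym eq_y); rewrite lt_x => ->.
  by rewrite -val_eqE /= eq_sym (ltn_eqF lt_xy).
- by rewrite ltnn eqxx.
Qed.

(** These conditions characterize the height of an entry, capped at [d], which is
    why they determine the colouring. *)
Definition graded d n (p : 'S_n) (col : 'I_n -> nat) : Prop :=
  [/\ forall x, col x <= d,
      forall x y : 'I_n, x < y -> p x < p y -> col y < d -> col x < col y &
      forall y : 'I_n, 0 < col y ->
        exists x : 'I_n, [/\ x < y, p x < p y & col y = (col x).+1]].

Lemma graded_unique d n (p : 'S_n) col col' :
  graded d p col -> graded d p col' -> col =1 col'.
Proof.
suff le c c' : graded d p c -> graded d p c' ->
    forall y : 'I_n, (forall x : 'I_n, x < y -> c x = c' x) -> c y <= c' y.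
  move=> gr gr' y; have [m] := ubnP (val y); elim: m y => // m IHm y.
  rewrite ltnS => le_y.
  have IH (x : 'I_n) : x < y -> col x = col' x.
    by move=> lt_x; apply/IHm/(leq_trans lt_x).
  apply/anti_leq; rewrite !le // => x lt_x; by rewrite IH.
move=> [c_le _ c_pred] [_ c_lt' _] y eq_below.
case: (posnP (c y)) => [-> //|/c_pred[x [lt_x lt_p ey]]].
case: (ltnP (c' y) d) => [/(c_lt' x y lt_x lt_p)|].
  by rewrite ey eq_below.
exact/leq_trans.
Qed.

Lemma graded_avoids d n (p : 'S_n) col : graded d p col ->
  (forall x y : 'I_n, x < y -> col x = d -> p x < p y) ->
  avoids p (Aki d.+2 d.+2).
Proof.
move=> [c_le c_lt _] tailP; apply/avoidsP => x y chx lt_xy; apply: tailP => //.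
apply/anti_leq; rewrite c_le /=.
suff: forall m z, m <= d -> chain p m z -> m <= col z by apply.
elim=> // m IHm z le_m /= /existsP[w /and3P[lt_w lt_p ch]].
case: (ltnP (col z) d) => [/(c_lt w z lt_w lt_p)|]; last exact: leq_trans.
by apply: leq_ltn_trans; apply: IHm => //; apply: ltnW.
Qed.

(** Colour classes of equal size [N] and the ballot property in both words force
    the colour to be the capped height. Number each class from 0 along the
    positions; then the values of the class are numbered in the opposite order by
    [N.-1 - i]. The ballot property puts the [i]-th entry of colour [c] to the left
    of the [i]-th entry of colour [c.+1], and, since both have index [N.-1 - i]
    among the values, also below it: every entry of colour [c.+1] has a predecessor
    of colour [c]. Conversely, if an entry of colour [c' > c] were to the left of
    and below one of colour [c], the ballot property of the positions would make
    its index the smaller one, and that of the values the larger one. A tail entry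
    has a predecessor of colour [d.-1] because such a value precedes all tail
    values. *)
Lemma fits_graded d n u v (p : 'S_n) N :
  size u = n -> size v = n -> fits d u v p ->
  ballot d u -> ballot d v -> all (leq^~ d) u ->
  (forall c, c < d -> count_mem c u = N) ->
  (forall c, c < d -> count_mem c v = N) ->
  (forall x y : 'I_n, x < y -> nth d u x = d -> nth d u y = d) ->
  (forall y : 'I_n, nth d v y = d -> d.-1 \in take y v) ->
  graded d p (fun x => nth d u x).
Proof.
move=> sz_u sz_v fit bal_u bal_v le_u N_u N_v tail_u tail_v.
have [col mono] := fit.
have idx (x : 'I_n) : nth d u x < d ->
  (count_mem (nth d u x) (take (p x) v) + count_mem (nth d u x) (take x u)).+1 = N.
  by move=> lt_x; rewrite fits_index // N_u.
have c_le (x : 'I_n) : nth d u x <= d.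
  by apply: (allP le_u); rewrite mem_nth // sz_u.
split=> // [x y lt_xy lt_p lt_y|y pos_y].
  rewrite ltnNge; apply/negP => le_yx.
  case: (ltnP (nth d u x) d) => [lt_x|ge_x]; last first.
    have e : nth d u x = d by apply/anti_leq; rewrite ge_x c_le.
    by rewrite (tail_u x y) ?ltnn in lt_y.
  move: le_yx; rewrite leq_eqVlt => /orP[/eqP e|lt_c].
    by have := mono x y lt_xy (esym e); rewrite lt_x; lia.
  have lt_cc : nth d u y < nth d u x < d by rewrite lt_c.
  have no_u : count_mem (nth d u x) (take x u) < count_mem (nth d u y) (take y u).
    rewrite ltnNge; apply/negP => le; have : y < x.
      by apply: (ballot_lt bal_u lt_cc) le; rewrite ?sz_u.
    by lia.
  have no_v : count_mem (nth d u x) (take (p x) v) < count_mem (nth d u y) (take (p y) v).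
    rewrite ltnNge; apply/negP => le; have : p y < p x.
      by apply: (ballot_lt bal_v lt_cc) le; rewrite ?col ?sz_v.
    by lia.
  by have := idx x lt_x; have := idx y lt_y; lia.
case: (ltnP (nth d u y) d) => [lt_y|ge_y]; last first.
  have ey : nth d u y = d by apply/anti_leq; rewrite ge_y c_le.
  have := tail_v (p y); rewrite col => /(_ ey) in_v.
  have lt_j : index d.-1 v < p y.
    have := in_v; rewrite -{2}(cat_take_drop (p y) v) index_cat => ->.
    rewrite -[X in _ < X](size_takel (s := v)) ?index_mem //.
    by rewrite sz_v ltnW.
  have lt_n : index d.-1 v < n by apply: ltn_trans lt_j _.
  pose x := ((p^-1)%g (Ordinal lt_n)).
  have px : p x = Ordinal lt_n by rewrite permKV.
  have ux : nth d u x = d.-1.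
    by rewrite -col px /= nth_index // (mem_take in_v).
  have dpos : 0 < d by rewrite -ey.
  exists x; split; [| by rewrite px | by rewrite ux ey prednK].
  case: (ltngtP x y) => // [lt_yx|/val_inj e].
    have := tail_u y x lt_yx ey; rewrite ux => e.
    by move: dpos; rewrite -{1}e; lia.
  by move: lt_j; rewrite -e px ltnn.
move ec: (nth d u y) pos_y => [//|c] _.
have lt_c : c < c.+1 < d by rewrite ltnSn -ec.
have idx_y := idx y lt_y; rewrite ec in idx_y.
have [|x [lt_x ux cx]] := @nth_occurrence d u c (count_mem c.+1 (take y u)).
  by rewrite N_u; lia.
rewrite sz_u in lt_x; pose x' := Ordinal lt_x.
have idx_x := idx x'; rewrite /= ux cx in idx_x.
have {}idx_x := idx_x (ltn_trans (ltnSn c) (proj2 (andP lt_c))).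
exists x'; split; last by rewrite /= ux.
  by apply: (ballot_lt bal_u lt_c) => //=; rewrite ?sz_u // cx.
have eq_c : count_mem c (take (p x') v) = count_mem c.+1 (take (p y) v).
  by move: idx_x; rewrite -idx_y => /succn_inj/addIn.
by apply: (ballot_lt bal_v lt_c); rewrite ?sz_v ?col ?eq_c.
Qed.

(** * Assembling ballot words from balanced blocks *)
Lemma ballot_from_cat d o w1 w2 : ballot_from d o w1 ->
  ballot_from d (fun c => o c + count_mem c w1) w2 -> ballot_from d o (w1 ++ w2).
Proof.
move=> bal1 bal2 m c c' lt_c; rewrite take_cat; case: ifP => _; first exact: bal1.
by rewrite !count_cat !addnA; apply: bal2.
Qed.

(** In a nondecreasing word all copies of a smaller letter come before the first
    copy of a larger one, so only the two extreme prefixes matter. *)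
Lemma ballot_from_sorted d o w : sorted leq w ->
  (forall c c', c < c' < d ->
     o c' <= o c /\ o c' + count_mem c' w <= o c + count_mem c w) ->
  ballot_from d o w.
Proof.
move=> srt_w le_o m c c' lt_c; have [le0 le1] := le_o c c' lt_c.
case: (boolP (c' \in take m w)) => [in_c'|/count_memPn ->]; last first.
  by rewrite addn0; apply: leq_trans le0 (leq_addr _ _).
have -> : count_mem c (take m w) = count_mem c w.
  rewrite -[in RHS](cat_take_drop m w) count_cat.
  suff /count_memPn -> : c \notin drop m w by rewrite addn0.
  apply/negP => in_c; move: srt_w; rewrite -(cat_take_drop m w).
  rewrite (sorted_pairwise leq_trans) pairwise_cat => /andP[/allrelP/(_ c' c in_c' in_c)].
  by move: lt_c; lia.
apply: leq_trans le1; rewrite leq_add2l.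
by rewrite -[in leqRHS](cat_take_drop m w) count_cat leq_addr.
Qed.

(** A block of length at most [L] disturbs a difference of letter counts by at
    most [L], and a balanced block leaves it unchanged when it is over: a lead of
    [L] at the start is never exhausted. *)
Lemma ballot_from_flatten d o L (ws : seq (seq nat)) :
  (forall c c', c < c' < d -> o c' + L <= o c) ->
  (forall w, w \in ws -> size w <= L) ->
  (forall w c c', w \in ws -> c < d -> c' < d -> count_mem c w = count_mem c' w) ->
  ballot_from d o (flatten ws).
Proof.
elim: ws o => [|w ws IHws] o slack sz_ws eq_ws /=.
  by move=> m c c' /slack; rewrite /= !addn0; apply/leq_trans/leq_addr.
have w_in : w \in w :: ws by rewrite mem_head.
apply: ballot_from_cat; last first.
  apply: IHws => [c c' lt_c|w' w'_in|w' c c' w'_in].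
  - have := slack c c' lt_c; have [lt1 lt2] := andP lt_c.
    by rewrite (eq_ws w c c' w_in (ltn_trans lt1 lt2) lt2); lia.
  - by apply: sz_ws; rewrite inE w'_in orbT.
  - by apply: eq_ws; rewrite inE w'_in orbT.
move=> m c c' lt_c; apply: leq_trans (leq_addr _ _).
apply: leq_trans (slack c c' lt_c); rewrite leq_add2l.
apply: leq_trans (count_size _ _) _; apply: leq_trans (sz_ws w w_in).
by rewrite size_take; case: ifP => // /ltnW.
Qed.

Definition ramp d (f : nat -> nat) : seq nat :=
  flatten [seq nseq (f c) c | c <- iota 0 d].

Lemma count_ramp d f c : count_mem c (ramp d f) = if c < d then f c else 0.
Proof.
rewrite /ramp; elim: d => [//|d IHd].
rewrite -addn1 iotaD map_cat flatten_cat count_cat {}IHd add0n /= cats0.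
rewrite count_nseq /= addn1 ltnS (leq_eqVlt c) eq_sym.
by case: ltngtP => [lt|lt|->] /=; rewrite ?mul1n ?mul0n ?addn0.
Qed.

Lemma mem_ramp d f c : c \in ramp d f -> c < d.
Proof. by move/flatten_mapP=> [b]; rewrite mem_iota mem_nseq => /andP[_ lt] /andP[_ /eqP ->]. Qed.

Lemma sorted_ramp d f : sorted leq (ramp d f).
Proof.
rewrite (sorted_pairwise leq_trans); elim: d => [//|d IHd].
rewrite /ramp -addn1 iotaD map_cat flatten_cat pairwise_cat -/(ramp d f) IHd /=.
rewrite cats0 add0n; apply/andP; split.
  apply/allrelP => a b /mem_ramp lt_a; rewrite mem_nseq => /andP[_ /eqP ->].
  exact: ltnW.
elim: (f d) => //= m ->; rewrite andbT; apply/allP => b.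
by rewrite mem_nseq => /andP[_ /eqP ->].
Qed.

(** The word [ascent d L] gives each letter below [d] a lead of [L] over its
    successor, and [descent d L] cancels these leads, so that in the end all
    letters are equally frequent. *)
Definition ascent d L := ramp d (fun c => (d - c) * L).
Definition descent d L := ramp d (fun c => c * L).

Lemma assembled_ballot d L ws r :
  (forall w, w \in ws -> size w <= L) ->
  (forall w c c', w \in ws -> c < d -> c' < d -> count_mem c w = count_mem c' w) ->
  ballot d (ascent d L ++ flatten ws ++ descent d L ++ nseq r d).
Proof.
move=> sz_ws eq_ws.
have step (c c' : nat) : c < c' < d -> (d - c') * L + L <= (d - c) * L.
  move=> lt_c; have: (d - c').+1 * L <= (d - c) * L.
    by rewrite leq_mul2r; apply/orP; right; lia.
  by rewrite mulSn; lia.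
have eq_count c c' : c < c' < d -> count_mem c (flatten ws) = count_mem c' (flatten ws).
  case/andP=> lt1 lt2; rewrite !count_flatten; congr sumn.
  by apply/eq_in_map => w w_in; apply: eq_ws => //; apply: ltn_trans lt2.
apply: ballot_from_cat.
  apply: ballot_from_sorted; first exact: sorted_ramp.
  move=> c c' lt_c; split=> //; have [lt1 lt2] := andP lt_c.
  rewrite !count_ramp lt2 (ltn_trans lt1 lt2) !add0n.
  by apply: leq_trans (step _ _ lt_c); apply: leq_addr.
apply: ballot_from_cat.
  apply: (ballot_from_flatten (L := L)) => // c c' lt_c; have [lt1 lt2] := andP lt_c.
  by rewrite !count_ramp lt2 (ltn_trans lt1 lt2) !add0n; apply: step.
have all_le : all (geq d) (descent d L).
  by apply/allP => c /mem_ramp/ltnW.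
apply: ballot_from_sorted.
  rewrite (sorted_pairwise leq_trans) pairwise_cat -(sorted_pairwise leq_trans).
  rewrite sorted_ramp /=; apply/andP; split.
    apply/allrelP => a b a_in; rewrite mem_nseq => /andP[_ /eqP ->].
    exact: (allP all_le).
  elim: r => //= m ->; rewrite andbT; apply/allP => b.
  by rewrite mem_nseq => /andP[_ /eqP ->].
move=> c c' lt_c; have [lt1 lt2] := andP lt_c; have lt_cd := ltn_trans lt1 lt2.
rewrite !count_cat !count_ramp lt2 lt_cd !add0n (eq_count c c' lt_c).
rewrite !count_nseq /= !(gtn_eqF, lt2, lt_cd) // !mul0n !addn0; split.
  by rewrite leq_add2r; apply: leq_trans (step c c' lt_c); apply: leq_addr.
have split_d (a : nat) : a < d -> (d - a) * L + a * L = d * L.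
  by move=> lt_a; rewrite -mulnDl subnK // ltnW.
by rewrite addnAC split_d // [leqRHS]addnAC split_d.
Qed.

(** * Balanced blocks of letters *)
Definition shift d (i : 'I_d.+1) (o : letter d.+1) : letter d.+1 :=
  omap (fun q => (q.1 + i, q.2 + i)%R) o.

Lemma shift_inj d (i : 'I_d.+1) : injective (shift i).
Proof.
move=> [[a b]|] [[a' b']|] //= /eqP.
rewrite -[_ == _]/((a + i, b + i)%R == (a' + i, b' + i)%R) xpair_eqE.
by rewrite !(inj_eq (addIr _)) => /andP[/eqP -> /eqP ->].
Qed.

(** Words of one common content, cyclically recoloured by all residues in turn:
    whatever the content, every colour occurs equally often in the concatenation,
    in both coordinates. *)
Definition balanced_block d (g : 'I_d.+1 -> seq (letter d.+1)) : seq (letter d.+1) :=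
  flatten [seq map (shift i) (g i) | i <- enum 'I_d.+1].

(** The counts of colours among positions and among values are the cases [fst] and
    [snd]. *)
Definition count_proj d (pi : 'I_d * 'I_d -> 'I_d) (c : nat) (e : seq (letter d)) : nat :=
  count (fun o => if o is Some q then val (pi q) == c else false) e.

Lemma count_firsts d c (e : seq (letter d)) : count_mem c (firsts e) = count_proj fst c e.
Proof. by elim: e => [//|[q|] e /= <-]. Qed.

Lemma count_valword d c (e : seq (letter d)) : c < d ->
  count_mem c (valword e) = count_proj snd c e.
Proof.
move=> lt_c; elim: e => [//|[q|] e /= ->] //; by rewrite (gtn_eqF lt_c).
Qed.

Lemma count_proj_block d pi (g : 'I_d.+1 -> seq (letter d.+1)) w0 c :
  (forall q i, pi (q.1 + i, q.2 + i)%R = (pi q + i)%R) ->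
  (forall i, perm_eq (g i) w0) -> c < d.+1 ->
  count_proj pi c (balanced_block g) = count isSome w0.
Proof.
move=> piP gP lt_c; pose c' := Ordinal lt_c.
rewrite /count_proj /balanced_block count_flatten -map_comp sumnE big_map big_enum /=.
transitivity (\sum_(i < d.+1) count_proj pi (c' - i)%R w0).
  apply: eq_bigr => i _ /=; rewrite count_map /count_proj -(seq.permP (gP i)).
  apply: eq_count => -[q|] //=; rewrite piP.
  have := subr_eq c' (pi q) i; rewrite ![_ == pi q]eq_sym [c' == _]eq_sym.
  by move=> e; exact: esym e.
transitivity (\sum_(i < d.+1) count_proj pi i w0).
  have /= sub_inj : injective (fun i : 'I_d.+1 => c' - i)%R.
    by move=> i j /addrI/oppr_inj.
  by rewrite [RHS](reindex_inj sub_inj).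
elim: w0 {gP} => [|o w IHw]; first by rewrite big1.
rewrite /= -IHw big_split /=; congr (_ + _); case: o => [q|]; last by rewrite big1.
rewrite (bigD1 (pi q)) //= eqxx big1 // => i /negbTE ne_i.
by rewrite val_eqE eq_sym ne_i.
Qed.

Lemma firsts_cat d (e e' : seq (letter d)) : firsts (e ++ e') = firsts e ++ firsts e'.
Proof. by rewrite /firsts pmap_cat map_cat. Qed.

Lemma firsts_flatten d (es : seq (seq (letter d))) :
  firsts (flatten es) = flatten (map (@firsts d) es).
Proof. by elim: es => //= e es <-; rewrite firsts_cat. Qed.

Definition ramp_letters d (f : nat -> nat) : seq (letter d) :=
  flatten [seq nseq (f c) (Some (c, c)) | c : 'I_d <- enum 'I_d].

Lemma firsts_ramp d f : firsts (ramp_letters d f) = ramp d f.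
Proof.
rewrite /ramp_letters firsts_flatten /ramp -val_enum_ord -!map_comp.
congr flatten; apply: eq_map => c /=.
by elim: (f c) => //= m; rewrite /firsts /= => ->.
Qed.

Lemma valword_ramp d f : valword (ramp_letters d f) = ramp d f.
Proof.
rewrite /valword /ramp_letters map_flatten /ramp -val_enum_ord -!map_comp.
by congr flatten; apply: eq_map => c /=; rewrite map_nseq.
Qed.

Lemma size_ramp d f : size (ramp_letters d f) = \sum_(c < d) f c.
Proof.
rewrite size_flatten /shape -map_comp sumnE big_map big_enum /=.
by apply: eq_bigr => c _; rewrite size_nseq.
Qed.

(** * The lower bound for words of one content *)


(** Both colour words of this word have the shape treated by
    [assembled_ballot]. *)
Definition assembled d L (bs : seq (seq (letter d))) r : seq (letter d) :=
  ramp_letters d (fun c => (d - c) * L) ++ flatten bs ++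
  ramp_letters d (fun c => c * L) ++ nseq r None.

Lemma size_assembled d L (bs : seq (seq (letter d))) r :
  (forall b, b \in bs -> size b = L) ->
  size (assembled L bs r) = d * d * L + size bs * L + r.
Proof.
move=> sz_bs; rewrite !size_cat !size_ramp size_nseq.
have -> : size (flatten bs) = size bs * L.
  elim: bs sz_bs => //= b bs IHbs sz_bs; rewrite size_cat sz_bs ?mem_head //.
  by rewrite IHbs // => b' b'_in; apply: sz_bs; rewrite inE b'_in orbT.
have <- : \sum_(c < d) (d - c) * L + \sum_(c < d) c * L = d * d * L.
  rewrite -big_split (eq_bigr (fun=> d * L)) => [|c _] /=; last first.
    by rewrite -mulnDl subnK // ltnW.
  by rewrite sum_nat_const card_ord mulnA.
by lia.
Qed.

Lemma posword_assembled d L (bs : seq (seq (letter d))) r :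
  exists r', posword (assembled L bs r) =
    ascent d L ++ flatten (map (@firsts d) bs) ++ descent d L ++ nseq r' d.
Proof.
exists (count_mem None (assembled L bs r)).
rewrite /posword {1}/assembled !firsts_cat !firsts_ramp firsts_flatten.
suff -> : firsts (nseq r None : seq (letter d)) = [::] by rewrite cats0 -!catA.
by elim: r.
Qed.

Lemma valword_assembled d L (bs : seq (seq (letter d))) r :
  valword (assembled L bs r) =
    ascent d L ++ flatten (map (@valword d) bs) ++ descent d L ++ nseq r d.
Proof.
have cat e e' : valword (e ++ e') = valword e ++ valword e' :> seq nat by exact: map_cat.
rewrite /assembled !cat !valword_ramp [valword (flatten _)]map_flatten.
by rewrite [valword (nseq _ _)]map_nseq.
Qed.

Lemma count_assembled d L (ws : seq (seq nat)) r s c : c < d ->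
  (forall w, w \in ws -> count_mem c w = s) ->
  count_mem c (ascent d L ++ flatten ws ++ descent d L ++ nseq r d) =
    d * L + size ws * s.
Proof.
move=> lt_c eq_ws; rewrite !count_cat !count_ramp lt_c count_nseq /=.
rewrite (gtn_eqF lt_c) mul0n addn0 addnCA addnC -mulnDl subnK; last exact: ltnW.
congr (_ + _); elim: ws eq_ws => //= w ws IHws eq_ws.
rewrite count_cat eq_ws ?mem_head // IHws // => w' w'_in.
by apply: eq_ws; rewrite inE w'_in orbT.
Qed.

Lemma assembled_decodes d L (bs : seq (seq (letter d))) r s :
  0 < d -> 0 < L ->
  (forall b, b \in bs -> size b = L) ->
  (forall b c, b \in bs -> c < d -> count_proj fst c b = s) ->
  (forall b c, b \in bs -> c < d -> count_proj snd c b = s) ->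
  let e := assembled L bs r in forall n, size e = n ->
  (exists p : 'S_n, fits d (posword e) (valword e) p) /\
  (forall p : 'S_n, fits d (posword e) (valword e) p ->
     graded d p (fun x => nth d (posword e) x) /\ avoids p (Aki d.+2 d.+2)).
Proof.
move=> d_gt0 L_gt0 sz_bs fst_bs snd_bs e n sz_e.
have [r' uE] := posword_assembled L bs r; have vE := valword_assembled L bs r.
rewrite -/e in uE vE.
have sz_u : size (posword e) = n by rewrite size_posword.
have sz_v : size (valword e) = n by rewrite size_valword.
have N_u c : c < d -> count_mem c (posword e) = d * L + size bs * s.
  move=> lt_c; rewrite uE (count_assembled L r' (s := s) lt_c) ?size_map //.
  by move=> w /mapP[b b_in ->]; rewrite count_firsts fst_bs.
have N_v c : c < d -> count_mem c (valword e) = d * L + size bs * s.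
  move=> lt_c; rewrite vE (count_assembled L r (s := s) lt_c) ?size_map //.
  by move=> w /mapP[b b_in ->]; rewrite count_valword // snd_bs.
have le_u : all (leq^~ d) (posword e).
  rewrite all_cat; apply/andP; split.
    by apply/allP => c /mapP[q _ ->]; apply: (ltnW (ltn_ord _)).
  by apply/allP => c; rewrite mem_nseq => /andP[_ /eqP ->].
have le_v : all (leq^~ d) (valword e).
  by apply/allP => c /mapP[[q|] _ ->] //; apply: (ltnW (ltn_ord _)).
have tail_u (x y : nat) : x < y -> nth d (posword e) x = d -> nth d (posword e) y = d.
  move=> lt_xy; rewrite !nth_cat !nth_nseq !if_same.
  case: ltnP => [lt_x|ge_x _]; last by case: ltnP => // lt_y; lia.
  move=> ex; have /mapP[q _ eq] := mem_nth d lt_x.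
  by have := ltn_ord q.1; rewrite -[nat_of_ord _]/(val q.1) -eq ex ltnn.
have tail_v y : y < n -> nth d (valword e) y = d -> d.-1 \in take y (valword e).
  move=> lt_y; rewrite vE nth_cat take_cat; case: ltnP => [lt_r|_ _].
    by move=> ey; have := mem_ramp (mem_nth d lt_r); rewrite ey ltnn.
  rewrite mem_cat; apply/orP; left; rewrite -has_pred1 has_count count_ramp.
  by rewrite ltn_predL d_gt0 muln_gt0 L_gt0 subn_gt0 ltn_predL d_gt0.
have bal_u : ballot d (posword e).
  rewrite uE; apply: assembled_ballot => [w|w c c'] /mapP[b b_in ->].
    by rewrite -(sz_bs b b_in) -size_firsts leq_addr.
  by move=> lt_c lt_c'; rewrite !count_firsts !fst_bs.
have bal_v : ballot d (valword e).
  rewrite vE; apply: assembled_ballot => [w|w c c'] /mapP[b b_in ->].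
    by rewrite size_valword sz_bs.
  by move=> lt_c lt_c'; rewrite !count_valword // !snd_bs.
split.
  apply: fits_exists => //; apply/allP => c; rewrite mem_cat => c_in /=.
  have : c <= d by case/orP: c_in; [apply: (allP le_u) | apply: (allP le_v)].
  rewrite leq_eqVlt => /orP[/eqP ->|lt_c]; last by rewrite N_u ?N_v.
  rewrite count_tail /posword count_cat count_nseq /= eqxx mul1n.
  suff /count_memPn -> : d \notin firsts e by [].
  apply/negP => /mapP[q _ eq]; have := ltn_ord q.1.
  by rewrite -[nat_of_ord _]/(val q.1) -eq ltnn.
move=> p fit; have gr : graded d p (fun x => nth d (posword e) x).
  apply: (fits_graded sz_u sz_v fit bal_u bal_v le_u N_u N_v).
    by move=> x y; apply: tail_u.
  by move=> y; apply: tail_v.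
split=> //; apply: (graded_avoids gr) => x y lt_xy ux.
have [_ mono] := fit; have := mono x y lt_xy.
by rewrite ux (tail_u x y lt_xy ux) ltnn; apply.
Qed.


(** The words assembled from arbitrary members of [X] yield distinct avoiders: by
    [assembled_decodes] the colouring, hence both colour words, can be read off
    from the permutation, and all pieces have known lengths. *)
Lemma Av_ge d l t r (X : {set l.-tuple (letter d.+1)}) (D := d.+1) :
  0 < l -> (forall w w', w \in X -> w' \in X -> perm_eq w w') ->
  #|X| ^ (t * D) <= Av (D * D * (D * l) + t * (D * l) + r) (Aki D.+2 D.+2).
Proof.
move=> l_gt0 eqX.
pose block (g : {ffun 'I_t * 'I_D -> l.-tuple (letter D)}) (b : 'I_t) :=
  balanced_block (fun i => g (b, i) : seq _).
pose code g := assembled (D * l) [seq block g b | b <- enum 'I_t] r.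
have L_gt0 : 0 < D * l by rewrite muln_gt0.
have sz_block g b : size (block g b) = D * l.
  rewrite size_flatten /shape -map_comp sumnE big_map big_enum /=.
  rewrite (eq_bigr (fun=> l)) => [|i _]; first by rewrite sum_nat_const card_ord.
  by rewrite size_map size_tuple.
have sz_code g : size (code g) = D * D * (D * l) + t * (D * l) + r.
  rewrite size_assembled => [|b /mapP[b' _ ->]]; last exact: sz_block.
  by rewrite size_map size_enum_ord.
have code_inj : injective code.
  move=> g g' /eqP; rewrite /code /assembled eqseq_cat // eqxx /=.
  have shapes : shape [seq block g b | b <- enum 'I_t] =
                shape [seq block g' b | b <- enum 'I_t].
    by rewrite /shape -!map_comp; apply: eq_map => b /=; rewrite !sz_block.
  rewrite eqseq_cat ?size_flatten ?shapes // => /andP[/eqP eq_fl _].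
  have /eq_in_map eq_b := eq_from_flatten_shape eq_fl shapes.
  apply/ffunP => -[b i]; have {}eq_b := eq_b b (mem_enum _ _).
  have /eq_in_map eq_i : [seq map (shift i) (g (b, i) : seq _) | i <- enum 'I_D] =
      [seq map (shift i) (g' (b, i) : seq _) | i <- enum 'I_D].
    apply: eq_from_flatten_shape => //; rewrite /shape -!map_comp.
    by apply: eq_map => j /=; rewrite !size_map !size_tuple.
  by apply/val_inj/(inj_map (@shift_inj d i))/eq_i; rewrite mem_enum.
rewrite -[in leqLHS](card_ord t) -[in leqLHS](card_ord D) -card_prod -card_ffun_on.
pose n := D * D * (D * l) + t * (D * l) + r.
pose R g (p : 'S_n) := fits D (posword (code g)) (valword (code g)) p.
have decodes g : g \in ffun_on (mem X) -> (exists p, R g p) /\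
    (forall p, R g p -> graded D p (fun x => nth D (posword (code g)) x) /\
                        avoids p (Aki D.+2 D.+2)).
  move=> /ffun_onP gX.
  case: (posnP t) => [t0|t_gt0].
    apply: (@assembled_decodes D (D * l) _ r 0 _ _ _ _ _ n (sz_code g)) => //.
    - by move=> b /mapP[b' _ ->]; apply: sz_block.
    - by move=> b c /mapP[b' _]; have := ltn_ord b'; rewrite {2}t0.
    - by move=> b c /mapP[b' _]; have := ltn_ord b'; rewrite {2}t0.
  pose w0 := g (Ordinal t_gt0, ord0).
  have eq_w0 b i : perm_eq (g (b, i)) w0 by apply: eqX; apply: gX.
  apply: (@assembled_decodes D (D * l) _ r (count isSome w0) _ _ _ _ _ n (sz_code g)) => //.
  - by move=> b /mapP[b' _ ->]; apply: sz_block.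
  - by move=> b c /mapP[b' _ ->]; apply: count_proj_block.
  - by move=> b c /mapP[b' _ ->]; apply: count_proj_block.
apply: (@leq_card_rel _ _ _ _ R) => [g /decodes[[p Rp] dec]|g g' p gX gX' Rp Rp'].
  by exists p; rewrite // inE; have [] := dec p Rp.
have [gr _] := (decodes g gX).2 p Rp; have [gr' _] := (decodes g' gX').2 p Rp'.
have eq_col := graded_unique gr gr'.
apply: code_inj; apply: words_inj.
  apply: (@eq_from_nth _ D); rewrite !size_posword !sz_code // => x lt_x.
  exact: (eq_col (Ordinal lt_x)).
apply: (@eq_from_nth _ D); rewrite !size_valword !sz_code // => y lt_y.
have [col _] := Rp; have [col' _] := Rp'.
have := col ((p^-1)%g (Ordinal lt_y)); have := col' ((p^-1)%g (Ordinal lt_y)).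
by rewrite permKV /= eq_col => -> ->.
Qed.

(** Pigeonhole: there are at most [l.+1 ^ #|A|] contents. *)
Lemma popular_content (A : finType) l : exists X : {set l.-tuple A},
  (forall w w', w \in X -> w' \in X -> perm_eq w w') /\
  #|A| ^ l <= #|X| * l.+1 ^ #|A|.
Proof.
pose content (w : l.-tuple A) : {ffun A -> 'I_l.+1} := [ffun a => inord (count_mem a w)].
pose X c := [set w | content w == c]%SET.
have [c0 maxX] : exists c0, forall c, #|X c| <= #|X c0|.
  exists [arg max_(c > [ffun=> ord0]) #|X c|]%N.
  by case: arg_maxnP => // c0 _ maxX c; apply: maxX.
exists (X c0); split=> [w w'|].
  rewrite !inE => /eqP <- /eqP/ffunP eqc; rewrite /perm_eq; apply/allP => a _ /=.
  have lt_count (s : l.-tuple A) : count_mem a s < l.+1.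
    by rewrite ltnS -[leqRHS](size_tuple s) count_size.
  by have := congr1 val (eqc a); rewrite !ffunE /= !inordK // => ->.
have -> : #|A| ^ l = \sum_c #|X c|.
  rewrite -card_tuple -sum1_card (partition_big content xpredT) //=.
  apply: eq_bigr => c _; rewrite -[RHS]sum1_card.
  by apply: eq_bigl => w; rewrite inE.
have -> : l.+1 ^ #|A| = #|{: {ffun A -> 'I_l.+1}}| by rewrite card_ffun card_ord.
by rewrite mulnC -sum_nat_const; apply: leq_sum => c _; apply: maxX.
Qed.

(** * The limit *)

Local Open Scope ring_scope.

Lemma bernoulli (R : realType) (s : R) l : 1 <= s -> 1 + l%:R * (s - 1) <= s ^+ l.
Proof.
move=> s_ge1; elim: l => [|l IHl]; first by rewrite mul0r addr0 expr0.
rewrite exprS; apply: (@le_trans _ _ (s * (1 + l%:R * (s - 1)))); last first.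
  by rewrite ler_wpM2l //; lra.
have : 0 <= l%:R * (s - 1) ^+ 2 by rewrite mulr_ge0 ?sqr_ge0.
by rewrite -natr1 expr2; nra.
Qed.

Lemma expr_unbounded (R : realType) (s C : R) : 1 < s ->
  exists l0, forall l, (l0 <= l)%N -> C <= s ^+ l.
Proof.
move=> s_gt1; exists (Num.trunc (C / (s - 1))).+1 => l le_l.
apply: le_trans (bernoulli l (ltW s_gt1)).
have s1_gt0 : 0 < s - 1 by lra.
have : C / (s - 1) <= l%:R.
  by apply: ltW; apply: lt_le_trans (truncnS_gt _) _; rewrite ler_nat.
by rewrite ler_pdivrMr //; lra.
Qed.

(** Induction on the degree: with [s] the square root of [r], one factor
    [s ^+ l] absorbs a linear factor and the other one the remaining power. *)
Lemma poly_le_expr (R : realType) m (r : R) : 1 < r ->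
  exists2 C : R, 0 <= C & forall l : nat, l.+1%:R ^+ m <= C * r ^+ l.
Proof.
elim: m r => [|m IHm] r r_gt1.
  exists 1 => // l; rewrite expr0 mul1r.
  by apply: exprn_ege1; apply: ltW.
pose s := Num.sqrt r.
have s_gt1 : 1 < s by rewrite -sqrtr1 ltr_sqrt //; lra.
have [C C_ge0 CP] := IHm s s_gt1.
have s1_gt0 : 0 < s - 1 by lra.
pose C' := 1 + (s - 1)^-1.
have C'_ge0 : 0 <= C' by rewrite addr_ge0 ?invr_ge0 ?ltW.
exists (C * C') => [|l]; first exact: mulr_ge0.
have lin : l.+1%:R <= C' * s ^+ l.
  apply: (@le_trans _ _ (C' * (1 + l%:R * (s - 1)))); last first.
    by rewrite ler_wpM2l // bernoulli // ltW.
  have -> : C' * (1 + l%:R * (s - 1)) =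
      1 + (s - 1)^-1 + l%:R * (s - 1) + l%:R :> R.
    by rewrite /C'; field; rewrite gt_eqF.
  have inv_gt0 : 0 < (s - 1)^-1 by rewrite invr_gt0.
  have l_ge0 : 0 <= l%:R :> R by [].
  by rewrite -natr1; nra.
have -> : r ^+ l = s ^+ l * s ^+ l.
  by rewrite -exprMn -expr2 sqr_sqrtr //; lra.
by rewrite exprSr mulrACA; apply: ler_pM.
Qed.

Lemma exists_poly_le_expr (R : realType) m (r : R) : 1 < r ->
  exists2 l, (0 < l)%N & l.+1%:R ^+ m <= r ^+ l.
Proof.
move=> r_gt1; pose s := Num.sqrt r.
have s_gt1 : 1 < s by rewrite -sqrtr1 ltr_sqrt //; lra.
have [C C_ge0 CP] := poly_le_expr m s_gt1.
have [l0 l0P] := expr_unbounded C s_gt1.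
exists l0.+1 => //; apply: le_trans (CP _) _.
have -> : r ^+ l0.+1 = s ^+ l0.+1 * s ^+ l0.+1.
  by rewrite -exprMn -expr2 sqr_sqrtr //; lra.
by apply: ler_wpM2r; [apply: exprn_ge0; lra | apply: l0P].
Qed.

(** For [a < a' < B], where [B] is the size of the alphabet, choose [l] so large
    that the polynomial loss in [popular_content] leaves at least [a' ^+ l] words of
    length [l] of one content. The ramps and the incomplete last block have bounded
    length and cost a constant factor, which the gap between [a] and [a']
    eventually outweighs. *)
Lemma Av_eventually_ge (R : realType) d (a : R) (D := d.+1) :
  0 < a -> a < (D ^ 2 + 1)%:R ->
  exists n0, forall n, (n0 <= n)%N -> a ^+ n <= (Av n (Aki D.+2 D.+2))%:R.
Proof.
move=> a_gt0 a_lt; set B := (D ^ 2 + 1)%N in a_lt *.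
have B_gt1 : 1 < B%:R :> R by rewrite ltr1n /B addn1 ltnS expn_gt0.
pose a' := (Num.max a 1 + B%:R) / 2.
have max_lt : Num.max a 1 < B%:R by rewrite gt_max a_lt.
have a_le : a <= Num.max a 1 by rewrite le_max lexx.
have one_le : 1 <= Num.max a 1 by rewrite le_max lexx orbT.
have a'_gt1 : 1 < a' by rewrite /a'; lra.
have a'_gta : a < a' by rewrite /a'; lra.
have a'_ltB : a' < B%:R by rewrite /a'; lra.
have a'_gt0 : 0 < a' by lra.
clearbody a'.
have [|l l_gt0 lP] := @exists_poly_le_expr _ B (B%:R / a').
  by rewrite ltr_pdivlMr // mul1r.
have [X [eqX cardX]] := popular_content (letter D) l.
have cardA : #|{: letter D}| = B.
  by rewrite card_option card_prod !card_ord /B addn1 mulnn.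
rewrite cardA in cardX.
have geX : a' ^+ l <= #|X|%:R.
  have pos : 0 < l.+1%:R ^+ B :> R by rewrite exprn_gt0.
  rewrite -(ler_pM2r pos); apply: (@le_trans _ _ (B ^ l)%:R); last first.
    by rewrite -natrX -natrM ler_nat.
  move: lP; rewrite expr_div_n ler_pdivlMr ?exprn_gt0 //.
  by rewrite natrX mulrC.
pose L := (D * l)%N; have L_gt0 : (0 < L)%N by rewrite muln_gt0.
have r_gt1 : 1 < a' / a by rewrite ltr_pdivlMr // mul1r.
have [n1 n1P] := expr_unbounded (a' ^+ (D * D * L + L)%N) r_gt1.
(* t complete blocks of length L fit after the two ramps of total length D * D * L. *)
exists (maxn n1 (D * D * L)) => n; rewrite geq_max => /andP[le_n1 le_n2].
pose t := ((n - D * D * L) %/ L)%N; pose r := ((n - D * D * L) %% L)%N.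
have nE : n = (D * D * L + t * L + r)%N.
  by rewrite -addnA -divn_eq subnKC.
have lt_r : (r < L)%N by rewrite ltn_mod.
have := Av_ge t r l_gt0 eqX; rewrite -/D -/L -nE -(ler_nat R) natrX.
apply: le_trans.
apply: (@le_trans _ _ (a' ^+ (t * L)%N)); last first.
  have -> : (t * L = l * (t * D))%N by rewrite /L mulnA mulnC.
  by rewrite exprM lerXn2r // nnegrE // exprn_ge0 // ltW.
have pos : 0 < a' ^+ (D * D * L + L)%N by rewrite exprn_gt0.
rewrite -(ler_pM2r pos) -exprD; apply: (@le_trans _ _ (a' ^+ n)).
  have := n1P n le_n1; rewrite expr_div_n ler_pdivlMr ?exprn_gt0 //.
  by rewrite mulrC.
by apply: ler_weXn2l; [exact: ltW | rewrite nE addnCA addnA leq_add2l ltnW].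
Qed.

Theorem theorem3p1 (R : realType) (k : nat) (hk : (3 <= k)%N) :
  has_growth_rate (Aki k k) ((k%:R - 2%:R) ^+ 2 + 1 : R).
Proof.
(* The number of colours below the tail colour is k - 2 = d.+1. *)
case: k hk => [|[|[|d]]] // _.
set lim := (_ + 1 : R).
have limE : lim = (d.+1 ^ 2 + 1)%:R.
  by rewrite /lim natrD natrX -[d.+3]addn2 -[(d.+1 + 2)%N]/(d.+1 + 2)%N natrD addrK.
have lim_gt0 : 0 < lim by rewrite limE ltr0n addn1.
apply/cvgrPdist_le => eps eps_gt0.
(* The maximum with lim / 2 keeps the lower bound positive when eps is large. *)
pose a := Num.max (lim - eps) (lim / 2).
have a_gt0 : 0 < a by rewrite lt_max orbC divr_gt0.
have a_lt : a < lim by rewrite gt_max; apply/andP; split; lra.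
have [n0 n0P] := @Av_eventually_ge R d a a_gt0 (eq_ind _ (fun x => a < x) a_lt _ limE).
exists (maxn n0 1) => // n /=; rewrite geq_max => /andP[le_n0 n_gt0].
have root (x : R) : 0 <= x -> (x ^+ n) `^ n%:R^-1 = x.
  move=> x_ge0; rewrite -powR_mulrn // -powRrM mulfV ?powRr1 //.
  by rewrite pnatr_eq0 -lt0n.
have inv_ge0 : 0 <= n%:R^-1 :> R by rewrite invr_ge0.
have root_mono (x y : R) : 0 <= x -> 0 <= y -> x <= y -> x `^ n%:R^-1 <= y `^ n%:R^-1.
  by move=> x_ge0 y_ge0; apply: (ge0_ler_powR inv_ge0); rewrite nnegrE.
have lower : a <= (Av n (Aki d.+3 d.+3))%:R `^ n%:R^-1.
  rewrite -[leLHS]root ?(ltW a_gt0) //; apply: root_mono => //.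
    exact/exprn_ge0/ltW.
  exact: n0P.
have upper : (Av n (Aki d.+3 d.+3))%:R `^ n%:R^-1 <= lim.
  rewrite -[leRHS]root ?(ltW lim_gt0) //; apply: root_mono => //.
    exact/exprn_ge0/ltW.
  by rewrite limE -natrX ler_nat Av_le.
have a_ge : lim - eps <= a by rewrite le_max lexx.
by rewrite ger0_norm; lra.
Qed.
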